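(* Let $n$ be a fixed natural number, $G=(V,E)$ a graph on vertex set $\{1,\dots,n\}$ with graph state $|G\rangle$ and stabilizer operators $g_1,\dots,g_n$, let $T>0$, $\beta=1/(k_BT)$, and let $\rho_T$ be the $n$-qubit thermal graph state at temperature $T$. Let $\ell\in\{0,1\}^n$ be arbitrary, and suppose the observable $S_\ell$ is measured on each of $N$ independent copies of $\rho_T$, producing outcomes $o_1,\dots,o_N\in\{+1,-1\}$, with $F_{\rm est}=\frac1N\sum_{i=1}^N o_i$. Then, in the limit $N\to\infty$, with probability one, $$\left|\langle G|\rho_T|G\rangle-F_{\rm est}\right| = \frac{\left|(n-2\,{\rm wt}(\ell))e^{-2\beta}+O(e^{-4\beta})\right|}{(1+e^{-2\beta})^n},$$ where ${\rm wt}(\ell)=\sum_{i=1}^n\ell_i$ is the Hamming weight and $O(e^{-4\beta})$ denotes terms of order $e^{-4\beta}$ and higher in $e^{-2\beta}$.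
   Context: For a graph $G=(V,E)$ on $n$ vertices, the graph state is $|G\rangle=\left(\prod_{(i,j)\in E}CZ_{i,j}\right)|+\rangle^{\otimes n}$, where $|+\rangle=(|0\rangle+|1\rangle)/\sqrt2$ and $CZ_{i,j}$ is the controlled-$Z$ gate on qubits $i,j$. Its stabilizer operators are $g_i=X_i\prod_{j:(i,j)\in E}Z_j$ for $1\le i\le n$, where $X_i,Z_j$ are Pauli operators on the indicated qubits. For $\ell=\ell_1\cdots\ell_n\in\{0,1\}^n$ let $S_\ell=\prod_{i=1}^n g_i^{\ell_i}$. Measuring $S_\ell$ on a state $\rho$ means performing the two-outcome projective measurement onto its $\pm1$ eigenspaces. With $\mathcal H=-\sum_{i=1}^n g_i$, the thermal graph state at temperature $T>0$ is $\rho_T=e^{-\beta\mathcal H}/{\rm Tr}[e^{-\beta\mathcal H}]$ with $\beta=1/(k_BT)$, $k_B$ the Boltzmann constant. *)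

(* Defs.v *)
From HB Require Import structures.
From mathcomp Require Import all_boot all_order all_algebra.
From mathcomp Require Import all_classical all_reals all_analysis.
Set Implicit Arguments. Unset Strict Implicit. Unset Printing Implicit Defensive.
Import Order.TTheory GRing.Theory Num.Theory.
Import numFieldNormedType.Exports.
Local Open Scope classical_set_scope.
Local Open Scope ring_scope.

(** * n-qubit operators.
   The computational basis of n qubits is indexed by bit strings
   s : {ffun 'I_n -> bool}; an n-qubit operator is a real square matrix
   of size #|bits n| = 2^n, the row/column index k standing for the basis
   vector |enum_val k>.  All operators occurring in the statement
   (X, Z, CZ, |+>, g_i, S_l, H, rho_T) have real entries. *)

Definition bits (n : nat) := {ffun 'I_n -> bool}.
Definition dim (n : nat) : nat := #|{: bits n}|.
Definition bit_of {n : nat} (k : 'I_(dim n)) : bits n := enum_val k.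

Section Qubits.
Variables (R : realType) (n : nat).
Notation Op := 'M[R]_(dim n).

Definition flip (i : 'I_n) (s : bits n) : bits n :=
  [ffun j => if j == i then ~~ s j else s j].

Definition pauliX (i : 'I_n) : Op :=
  \matrix_(r, c) (if bit_of r == flip i (bit_of c) then 1 else 0).

Definition pauliZ (i : 'I_n) : Op :=
  \matrix_(r, c) (if r == c then (-1) ^+ bit_of c i else 0).

Definition CZ (i j : 'I_n) : Op :=
  \matrix_(r, c) (if r == c then (-1) ^+ (bit_of c i && bit_of c j) else 0).

Definition plus_state : 'cV[R]_(dim n) :=
  \col_r ((Num.sqrt 2)^-1 ^+ n).

(* A simple graph on vertex set 'I_n (= {1,...,n}) is a symmetric
   irreflexive relation adj; each edge {i,j} is listed once as i < j. *)
Definition graph_state (adj : rel 'I_n) : 'cV[R]_(dim n) :=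
  (\prod_(i < n) \prod_(j < n | (i < j)%N && adj i j) CZ i j)
    *m plus_state.

Definition stab (adj : rel 'I_n) (i : 'I_n) : Op :=
  pauliX i * \prod_(j | adj i j) pauliZ j.

Definition S_op (adj : rel 'I_n) (l : bits n) : Op :=
  \prod_(i < n) stab adj i ^+ l i.

Definition hamiltonian (adj : rel 'I_n) : Op := - \sum_(i < n) stab adj i.

Definition expm (A : Op) : Op :=
  lim (series (fun k : nat => (k`!%:R)^-1 *: A ^+ k) @ \oo).

Definition thermal_state (adj : rel 'I_n) (beta : R) : Op :=
  (\tr (expm (- beta *: hamiltonian adj)))^-1
    *: expm (- beta *: hamiltonian adj).

Definition fidelity (adj : rel 'I_n) (rho : Op) : R :=
  ((graph_state adj)^T *m rho *m graph_state adj) 0 0.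

(* Projector onto the o-eigenspace (o = +1 or -1) of the involution S
   (S_l^2 = 1), i.e. (1 + o S)/2, and Born-rule probability of outcome o. *)
Definition eig_proj (S : Op) (o : R) : Op := 2^-1 *: (1%:M + o *: S).
Definition outcome_prob (rho S : Op) (o : R) : R := \tr (rho *m eig_proj S o).

End Qubits.

Arguments pauliX {R n}.
Arguments pauliZ {R n}.
Arguments CZ {R n}.
Arguments plus_state {R n}.
Arguments graph_state {R n}.
Arguments stab {R n}.
Arguments S_op {R n}.
Arguments hamiltonian {R n}.

Definition wt {n : nat} (l : bits n) : nat := \sum_(i < n) (l i : nat).

Definition mutually_independent {d : measure_display} {T : measurableType d}
  {R : realType} (P : probability T R) (X : nat -> T -> R) : Prop :=
  forall (K : seq nat), uniq K ->
  forall (A : nat -> set R), (forall k, measurable (A k)) ->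
  P (\big[setI/setT]_(k <- K) (X k @^-1` A k))
    = (\prod_(k <- K) P (X k @^-1` A k))%E.

Definition F_est {T : Type} {R : realType} (o : nat -> T -> R) (N : nat) (t : T) : R :=
  (N%:R)^-1 * \sum_(i < N) o i t.

(* Main.v *)
Require Import Defs.
From HB Require Import structures.
From mathcomp Require Import all_boot all_order all_algebra.
From mathcomp Require Import all_classical all_reals all_analysis.
From mathcomp Require Import ring lra.
Import Order.TTheory GRing.Theory Num.Theory.
Import numFieldNormedType.Exports.
Local Open Scope classical_set_scope.
Local Open Scope ring_scope.

(** The [2^n] vectors [Z^s |G>] form an orthonormal basis in which every
   stabilizer generator is diagonal: [g_i] acts on [Z^s |G>] as [(-1)^(s_i)].
   With [x = e^(-2 beta)], the thermal state is thus diagonal with entries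
   [x^wt(s) / (1+x)^n], so that the fidelity with [|G>] is [1 / (1+x)^n] and
   [Tr(rho_T S_l) = prod_i (1 + (-1)^(l_i) x) / (1+x)^n]; the linear coefficient
   of that product is [n - 2 wt(l)].  The empirical mean tends almost surely to
   [Tr(rho_T S_l)]: a Chernoff bound, computed as a finite sum over sign
   patterns, makes the deviation probabilities summable, and Borel-Cantelli
   applies. *)

(** * Graph-state phases, characters and the orthonormal graph basis *)

Section Spectral.
Variables (R : realType) (n : nat).
Implicit Types (s : bits n) (f g : bits n -> R) (adj : rel 'I_n).

(** The sign of the amplitude of [|G>] at [s], that is, the diagonal entry at [s] of the full
    product of [CZ] gates. *)
Definition phase adj s : R :=
  \prod_(i < n) \prod_(j < n | (i < j)%N && adj i j) (-1) ^+ (s i && s j).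

(** The characters of the group of bit strings. They serve twice: as the entries of [Z^s'], and as
    the eigenvalue of [S_op adj l] on [Z^s |G>], namely [chi l s]. *)
Definition chi s s' : R := \prod_(i < n) (-1) ^+ (s i && s' i).

(* The column indexed by [s] is [Z^s |G>]. *)
Definition graph_basis adj : 'M[R]_(Defs.dim n) :=
  \matrix_(r, c) ((Num.sqrt 2)^-1 ^+ n
                  * (phase adj (bit_of r) * chi (bit_of r) (bit_of c))).

Lemma flipE i s j : flip i s j = s j (+) (j == i).
Proof. by rewrite ffunE; case: eqP; rewrite ?addbT ?addbF. Qed.

Lemma flipK i : involutive (@flip n i).
Proof. by move=> s; apply/ffunP => j; rewrite !flipE -addbA addbb addbF. Qed.

Lemma phase_sqr adj s : phase adj s * phase adj s = 1.
Proof.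
rewrite -big_split/= big1// => i _; rewrite -big_split/= big1// => j _.
by rewrite -signr_addb addbb.
Qed.

(** Moving [X_k] through the [CZ] gates leaves a [Z] on each neighbour of [k]; this is what makes
    [|G>] a fixed vector of [stab adj k]. *)
Lemma phase_flip adj (adj_sym : symmetric adj) (adj_irr : irreflexive adj) k s :
  phase adj (flip k s) = phase adj s * \prod_(j | adj k j) (-1) ^+ s j.
Proof.
(* Flipping [k] multiplies the factor of an edge by [-1] to the other endpoint
   if [k] is an endpoint; [h1] and [h2] treat [k] as the smaller, larger one. *)
pose h1 (i j : 'I_n) : R := if i == k then (-1) ^+ s j else 1.
pose h2 (i j : 'I_n) : R := if j == k then (-1) ^+ s i else 1.
have -> : phase adj (flip k s) = phase adj s *
    ((\prod_(i < n) \prod_(j < n | (i < j)%N && adj i j) h1 i j) *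
     (\prod_(i < n) \prod_(j < n | (i < j)%N && adj i j) h2 i j)).
  rewrite -!big_split/=; apply: eq_bigr => i _.
  rewrite -!big_split/=; apply: eq_bigr => j /andP[ij _].
  rewrite !flipE /h1 /h2; have : ~~ ((i == k) && (j == k)).
    by apply/negP => /andP[/eqP ik /eqP jk]; rewrite ik jk ltnn in ij.
  by do 2 case: eqP => _; case: (s i); case: (s j) => //= _;
    rewrite ?expr1 ?expr0 ?mulr1 ?mul1r ?mulN1r ?opprK.
congr (_ * _); rewrite [in RHS](bigID (fun j : 'I_n => (k < j)%N))/=; congr (_ * _).
  rewrite (bigD1 k)//= [X in _ * X]big1 ?mulr1; last first.
    by move=> i /negPf ik; rewrite big1// => j _; rewrite /h1 ik.
  by apply: eq_big => [j|j _]; rewrite /h1 ?eqxx// andbC.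
rewrite (exchange_big_dep xpredT)//= (bigD1 k)//= [X in _ * X]big1 ?mulr1; last first.
  by move=> j /negPf jk; rewrite big1// => i _; rewrite /h2 jk.
apply: eq_big => [i|i _]; last by rewrite /h2 eqxx.
(* For a neighbour [i] of [k], failing [k < i] means [i < k], because irreflexivity excludes
   [i = k]. *)
rewrite adj_sym andbC; case ki: (adj k i) => //=.
by rewrite ltn_neqAle leqNgt; case: eqP => // /val_inj ik; rewrite ik adj_irr in ki.
Qed.

Lemma chi_flip k s s' : chi (flip k s) s' = chi s s' * (-1) ^+ s' k.
Proof.
rewrite /chi (bigD1 k)//= [in RHS](bigD1 k)//= flipE eqxx mulrAC; congr (_ * _).
  by case: (s k); case: (s' k); rewrite //= ?expr1 ?expr0 ?mulr1 ?mul1r ?mulN1r ?opprK.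
by apply: eq_bigr => j /negPf jk; rewrite flipE jk addbF.
Qed.

Lemma sum_bit_of f : \sum_k f (bit_of k) = \sum_s f s.
Proof. by rewrite (big_enum_val (A := {: bits n})). Qed.

Lemma bit_of_inj : injective (@bit_of n).
Proof. exact: enum_val_inj. Qed.

(** The sum factorises over qubits, and a qubit on which [s] and [s'] differ contributes
    [1 - 1 = 0]. *)
Lemma chi_orth s s' : \sum_t chi t s * chi t s' = if s == s' then 2 ^+ n else 0.
Proof.
transitivity (\prod_(i < n) \sum_(b : bool) ((-1) ^+ (b && s i) * (-1) ^+ (b && s' i)) : R).
  by rewrite bigA_distr_bigA; apply: eq_bigr => t _; rewrite -big_split.
transitivity (\prod_(i < n) (if s i == s' i then 2 else 0) : R).
  apply: eq_bigr => i _; rewrite big_bool /=.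
  by case: (s i); case: (s' i); rewrite /= ?expr1 ?expr0; ring.
case: eqP => [->|ne].
  by under eq_bigr do rewrite eqxx; rewrite prodr_const card_ord.
have [i /negPf si] : exists i, s i != s' i.
  apply/existsP; rewrite -negb_forall; apply/negP => /forallP h.
  by apply: ne; apply/ffunP => i; exact/eqP.
by rewrite (bigD1 i)//= si mul0r.
Qed.

Lemma sqrt2V : ((Num.sqrt 2)^-1 ^+ n * (Num.sqrt 2)^-1 ^+ n) * 2 ^+ n = 1 :> R.
Proof.
rewrite -!exprMn -invfM -expr2 sqr_sqrtr ?ler0n//.
by rewrite mulVf ?expr1n// pnatr_eq0.
Qed.

Lemma graph_basis_orthol adj : (graph_basis adj)^T *m graph_basis adj = 1%:M.
Proof.
apply/matrixP => c d; rewrite !mxE.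
pose a : R := (Num.sqrt 2)^-1 ^+ n * (Num.sqrt 2)^-1 ^+ n.
transitivity (\sum_k a * (chi (bit_of k) (bit_of c) * chi (bit_of k) (bit_of d))).
  apply: eq_bigr => k _; rewrite !mxE -[RHS]mul1r.
  rewrite -[X in _ = X * _](phase_sqr adj (bit_of k)).
  by rewrite /a; ring.
rewrite -mulr_sumr (sum_bit_of (fun t => chi t (bit_of c) * chi t (bit_of d))) chi_orth.
rewrite (inj_eq bit_of_inj); case: eqP => _; last by rewrite mulr0.
exact: sqrt2V.
Qed.

Lemma graph_basis_orthor adj : graph_basis adj *m (graph_basis adj)^T = 1%:M.
Proof. exact/mulmx1C/graph_basis_orthol. Qed.

(** * Functional calculus for operators diagonal in the graph basis *)

Definition diag_op f : 'M[R]_(Defs.dim n) := diag_mx (\row_k f (bit_of k)).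

(* The operator acting on [Z^s |G>] as the scalar [f s]. *)
Definition spec adj f : 'M[R]_(Defs.dim n) :=
  graph_basis adj *m diag_op f *m (graph_basis adj)^T.

Lemma eq_spec adj f g : f =1 g -> spec adj f = spec adj g.
Proof. by move=> fg; congr spec; apply/funext. Qed.

Lemma specM adj f g : spec adj f *m spec adj g = spec adj (fun s => f s * g s).
Proof.
rewrite /spec !mulmxA -(mulmxA _ _^T (graph_basis adj)) graph_basis_orthol mulmx1.
rewrite -(mulmxA _ (diag_op _) (diag_op _)); congr (_ *m _ *m _).
by rewrite /diag_op mulmx_diag; congr diag_mx; apply/rowP => k; rewrite !mxE.
Qed.

Lemma spec1 adj : spec adj (fun=> 1) = 1%:M.
Proof.
rewrite /spec (_ : diag_op _ = 1%:M) ?mulmx1 ?graph_basis_orthor//.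
by apply/matrixP => i j; rewrite !mxE.
Qed.

Lemma specD adj f g : spec adj f + spec adj g = spec adj (fun s => f s + g s).
Proof.
rewrite /spec -mulmxDl -mulmxDr; congr (_ *m _ *m _).
by rewrite /diag_op -raddfD; congr diag_mx; apply/rowP => k; rewrite !mxE.
Qed.

Lemma specZ adj a f : a *: spec adj f = spec adj (fun s => a * f s).
Proof.
rewrite /spec scalemxAl scalemxAr; congr (_ *m _ *m _).
by rewrite /diag_op -linearZ; congr diag_mx; apply/rowP => k; rewrite !mxE.
Qed.

Lemma spec0 adj : spec adj (fun=> 0) = 0.
Proof. by rewrite -(scale0r (spec adj (fun=> 0))) specZ; apply: eq_spec => s; rewrite mul0r. Qed.

Lemma spec_sum adj I (r : seq I) (Q : pred I) (F : I -> bits n -> R) :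
  \sum_(i <- r | Q i) spec adj (F i) = spec adj (fun s => \sum_(i <- r | Q i) F i s).
Proof.
elim: r => [|i r IH]; first by rewrite big_nil -(spec0 adj); apply: eq_spec => s; rewrite big_nil.
rewrite big_cons IH; case Qi: (Q i); rewrite ?specD; apply: eq_spec => s;
  by rewrite big_cons Qi.
Qed.

Lemma spec_prod adj I (r : seq I) (F : I -> bits n -> R) :
  \prod_(i <- r) spec adj (F i) = spec adj (fun s => \prod_(i <- r) F i s).
Proof.
elim: r => [|i r IH].
  by rewrite big_nil -[1]/(1%:M) -(spec1 adj); apply: eq_spec => s; rewrite big_nil.
by rewrite big_cons IH -[_ * _]/(_ *m _) specM; apply: eq_spec => s; rewrite big_cons.
Qed.

Lemma specX adj f k : spec adj f ^+ k = spec adj (fun s => f s ^+ k).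
Proof.
elim: k => [|k IH]; first by rewrite expr0 -[1]/(1%:M) -(spec1 adj).
by rewrite exprS IH -[_ * _]/(_ *m _) specM; apply: eq_spec => s; rewrite exprS.
Qed.

Lemma trace_spec adj f : \tr (spec adj f) = \sum_s f s.
Proof.
rewrite /spec mxtrace_mulC mulmxA graph_basis_orthol mul1mx /diag_op mxtrace_diag.
by under eq_bigr do rewrite mxE; exact: sum_bit_of.
Qed.

Lemma prod_diag_op I (r : seq I) (Q : pred I) (F : I -> bits n -> R) :
  \prod_(i <- r | Q i) diag_op (F i) = diag_op (fun s => \prod_(i <- r | Q i) F i s).
Proof.
elim: r => [|i r IH].
  rewrite big_nil -[1]/(1%:M); apply/matrixP => a b.
  by rewrite !mxE big_nil.
rewrite big_cons; case Qi: (Q i); last first.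
  by rewrite IH; congr diag_op; apply/funext => s; rewrite big_cons Qi.
rewrite IH -[_ * _]/(_ *m _) /diag_op mulmx_diag; congr diag_mx.
by apply/rowP => k; rewrite !mxE big_cons Qi.
Qed.

(** * Diagonalization of the stabilizers, the Hamiltonian and the fidelity *)

Lemma pauliZE i : pauliZ i = diag_op (fun s => (-1) ^+ s i).
Proof. by apply/matrixP => r c; rewrite !mxE; case: eqP => [->|]. Qed.

Lemma CZE i j : CZ i j = diag_op (fun s => (-1) ^+ (s i && s j)).
Proof. by apply/matrixP => r c; rewrite !mxE; case: eqP => [->|]. Qed.

(** In row [r], [pauliX i] selects the single index [flip i r]. There [phase_flip] produces the
    neighbour signs a second time, so they cancel against the [pauliZ j], and [chi_flip] leaves the
    eigenvalue. *)
Lemma stab_graph_basis adj (adj_sym : symmetric adj) (adj_irr : irreflexive adj) i :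
  stab adj i *m graph_basis adj
  = graph_basis adj *m diag_op (fun s => (-1) ^+ s i).
Proof.
rewrite /stab (eq_bigr _ (fun j _ => pauliZE j)) prod_diag_op.
rewrite -[_ * _]/(_ *m _) -mulmxA mul_mx_diag; apply/matrixP => r c.
rewrite 2!mxE; set c0 := bit_of c; set r0 := bit_of r.
pose F s := (if r0 == flip i s then 1 else 0) *
   (\prod_(j | adj i j) (-1) ^+ s j *
     ((Num.sqrt 2)^-1 ^+ n * (phase adj s * chi s c0))) : R.
transitivity (\sum_k F (bit_of k)).
  by apply: eq_bigr => k _; rewrite mul_diag_mx !mxE.
rewrite sum_bit_of (bigD1 (flip i r0))//= [X in _ + X]big1 ?addr0; last first.
  move=> s /eqP ne; rewrite /F; case: eqP => [e|_]; last by rewrite mul0r.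
  by case: ne; rewrite e flipK.
rewrite /F flipK eqxx mul1r !mxE phase_flip// chi_flip.
(* Vertex [i] is not its own neighbour, so flipping bit [i] does not change the neighbour signs. *)
have -> : \prod_(j | adj i j) (-1) ^+ flip i r0 j = \prod_(j | adj i j) (-1) ^+ r0 j :> R.
  apply: eq_bigr => j ij; rewrite flipE; case: eqP => [e|_]; last by rewrite addbF.
  by rewrite e adj_irr in ij.
set z := \prod_(j | adj i j) _; have zz : z * z = 1.
  by rewrite /z -big_split big1//= => j _; rewrite -signr_addb addbb.
rewrite -/r0 -/c0; set p := phase adj r0; set q := chi r0 c0; set s := (-1) ^+ c0 i; set a := _ ^+ n.
by transitivity ((z * z) * (a * (p * q) * s)); [ring | rewrite zz mul1r].
Qed.

Lemma stabE adj (adj_sym : symmetric adj) (adj_irr : irreflexive adj) i :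
  stab adj i = spec adj (fun s => (-1) ^+ s i).
Proof. by rewrite /spec -stab_graph_basis// -mulmxA graph_basis_orthor mulmx1. Qed.

Lemma S_opE adj (adj_sym : symmetric adj) (adj_irr : irreflexive adj) l :
  S_op adj l = spec adj (chi l).
Proof.
rewrite /S_op (eq_bigr (fun i => spec adj (fun s => (-1) ^+ (l i && s i)))) ?spec_prod//.
move=> i _; rewrite stabE// specX; apply: eq_spec => s.
by case: (l i); rewrite ?expr1 ?expr0.
Qed.

Lemma hamiltonianE adj (adj_sym : symmetric adj) (adj_irr : irreflexive adj) (beta : R) :
  - beta *: hamiltonian adj = spec adj (fun s => \sum_(i < n) beta * (-1) ^+ s i).
Proof.
rewrite /hamiltonian scaleNr scalerN opprK (eq_bigr _ (fun i _ => stabE _ adj_sym adj_irr i)).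
by rewrite spec_sum specZ; apply: eq_spec => s; rewrite mulr_sumr.
Qed.

(** The column of the zero string has trivial character, so only [phase] remains. *)
Lemma graph_stateE adj :
  graph_state adj = graph_basis adj *m (\col_k (bit_of k == [ffun=> false])%:R).
Proof.
rewrite /graph_state; under eq_bigr => i _ do under eq_bigr => j _ do rewrite CZE.
under eq_bigr => i _ do rewrite prod_diag_op.
rewrite prod_diag_op mul_diag_mx; apply/matrixP => r c; rewrite !mxE.
pose z : bits n := [ffun=> false].
rewrite (bigD1 (enum_rank z))//= [X in _ + X]big1 ?addr0; last first.
  move=> k; rewrite !mxE /bit_of -(inj_eq enum_val_inj) enum_rankK => /negPf ->.
  by rewrite mulr0.
rewrite !mxE /bit_of enum_rankK eqxx mulr1 mulrC -/(phase adj _).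
rewrite [chi _ _]big1 ?mulr1// => i _; by rewrite ffunE andbF.
Qed.

Lemma fidelity_spec adj f : fidelity adj (spec adj f) = f [ffun=> false].
Proof.
rewrite /fidelity graph_stateE trmx_mul /spec.
rewrite !mulmxA -(mulmxA _ _^T (graph_basis adj)) graph_basis_orthol mulmx1.
rewrite -(mulmxA _ _^T (graph_basis adj)) graph_basis_orthol mulmx1.
rewrite mul_mx_diag mxE.
pose z : bits n := [ffun=> false].
rewrite (bigD1 (enum_rank z))//= [X in _ + X]big1 ?addr0; last first.
  move=> k; rewrite !mxE /bit_of -(inj_eq enum_val_inj) enum_rankK => /negPf ->.
  by rewrite mulr0.
by rewrite !mxE /bit_of enum_rankK eqxx mulr1 mul1r.
Qed.

(** * Matrix exponential and the thermal state *)

Lemma specE adj f : spec adj f =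
  \sum_s f s *: spec adj (fun t => (t == s)%:R).
Proof.
rewrite (eq_bigr _ (fun s _ => specZ adj (f s) _)) spec_sum; apply: eq_spec => t.
rewrite (bigD1 t)//= eqxx mulr1 big1 ?addr0// => s /negPf ts.
by rewrite eq_sym ts mulr0.
Qed.

(** Expanding over the finitely many spectral projectors reduces matrix convergence to convergence
    of each eigenvalue. *)
Lemma cvg_spec adj (u : nat -> bits n -> R) f :
  (forall s, u ^~ s @ \oo --> f s) ->
  (fun k => spec adj (u k)) @ \oo --> spec adj f.
Proof.
move=> uf; rewrite specE; under eq_fun do rewrite specE.
apply: cvg_big => [|s _].
  exact: add_continuous.
exact: cvgZr_tmp (uf s).
Qed.

Lemma expm_spec adj f : expm (spec adj f) = spec adj (fun s => expR (f s)).
Proof.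
rewrite /expm (_ : series _ = fun k => spec adj (fun s => series (exp_coeff (f s)) k)).
  apply/cvg_lim; first exact: norm_hausdorff.
  by apply: cvg_spec => s; exact: is_cvg_series_exp_coeff.
apply/funext => N; rewrite /series/= -spec_sum; apply: eq_bigr => k _.
by rewrite specX specZ; apply: eq_spec => s; rewrite /exp_coeff /= mulrC.
Qed.

(** Both [x ^+ wt s] and [chi l s] are products over qubits, so the sum over strings is a product of
    two-term sums. *)
Lemma sum_wt_chi (x : R) l :
  \sum_s x ^+ wt s * chi l s = \prod_(i < n) (1 + (-1) ^+ l i * x).
Proof.
transitivity (\sum_(s : bits n) \prod_(i < n) (x ^+ s i * (-1) ^+ (l i && s i))).
  by apply: eq_bigr => s _; rewrite /wt expr_sum -big_split.
rewrite -(bigA_distr_bigA (fun i (b : bool) => x ^+ b * (-1) ^+ (l i && b))).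
apply: eq_bigr => i _; rewrite big_bool/= andbT andbF !expr0 expr1 mulr1.
by rewrite addrC mulrC.
Qed.

Lemma sum_wt (x : R) : \sum_(s : bits n) x ^+ wt s = (1 + x) ^+ n.
Proof.
have E (s : bits n) : x ^+ wt s = x ^+ wt s * chi [ffun=> false] s.
  by rewrite /chi big1 ?mulr1// => i _; rewrite ffunE.
rewrite (eq_bigr _ (fun s _ => E s)) sum_wt_chi.
rewrite (eq_bigr (fun=> 1 + x)) ?prodr_const ?card_ord// => i _.
by rewrite ffunE expr0 mul1r.
Qed.

(** A string [s] has energy [2 wt(s) - n], so its Gibbs weight is [expR beta ^+ n * x ^+ wt s]; the
    common factor cancels in the normalization. *)
Lemma thermal_stateE adj (adj_sym : symmetric adj) (adj_irr : irreflexive adj) (beta : R) :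
  let x := expR (- (2 * beta)) in
  thermal_state adj beta = spec adj (fun s => x ^+ wt s / (1 + x) ^+ n).
Proof.
move=> x; rewrite /thermal_state hamiltonianE// expm_spec trace_spec specZ.
have gibbs s : expR (\sum_(i < n) beta * (-1) ^+ s i) = expR beta ^+ n * x ^+ wt s.
  rewrite expR_sum /wt expr_sum.
  have -> : expR beta ^+ n = \prod_(i < n) expR beta by rewrite prodr_const card_ord.
  rewrite -big_split/=; apply: eq_bigr => i _; case: (s i); rewrite ?expr1 ?expr0 ?mulr1//.
  by rewrite -expRD; congr expR; ring.
rewrite (eq_bigr _ (fun s _ => gibbs s)) -mulr_sumr sum_wt.
apply: eq_spec => s; rewrite gibbs invfM mulrACA mulVf ?mul1r 1?mulrC//.
by rewrite expf_neq0// gt_eqF// expR_gt0.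
Qed.

Lemma fidelity_thermal adj (adj_sym : symmetric adj) (adj_irr : irreflexive adj) (beta : R) :
  fidelity adj (thermal_state adj beta) = ((1 + expR (- (2 * beta))) ^+ n)^-1.
Proof.
rewrite thermal_stateE// fidelity_spec /wt big1 ?expr0 ?mul1r// => i _.
by rewrite ffunE.
Qed.

(** For outcomes of value 1 and -1, twice the probability of 1 minus 1 is the mean, here
    [Tr(rho_T S_l)]. *)
Lemma outcome_prob_thermal adj (adj_sym : symmetric adj) (adj_irr : irreflexive adj)
    (beta : R) l :
  let x := expR (- (2 * beta)) in
  2 * outcome_prob (thermal_state adj beta) (S_op adj l) 1 - 1
  = (\prod_(i < n) (1 + (-1) ^+ l i * x)) / (1 + x) ^+ n.
Proof.
move=> x; rewrite /outcome_prob /eig_proj thermal_stateE// S_opE// -/x.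
rewrite scale1r -(spec1 adj) specD specZ specM trace_spec.
have -> : \sum_s x ^+ wt s / (1 + x) ^+ n * (2^-1 * (1 + chi l s))
   = 2^-1 * (\sum_s x ^+ wt s * chi [ffun=> false] s
             + \sum_s x ^+ wt s * chi l s) / (1 + x) ^+ n.
  rewrite -big_split mulr_sumr mulr_suml; apply: eq_bigr => s _ /=.
  rewrite [chi [ffun=> _] s]big1; first by ring.
  by move=> i _; rewrite ffunE.
rewrite !sum_wt_chi (eq_bigr (fun=> 1 + x)); last first.
  by move=> i _; rewrite ffunE expr0 mul1r.
rewrite prodr_const card_ord -/x; set y := _ ^+ n.
have y0 : y != 0 by rewrite expf_neq0// gt_eqF// addr_gt0// expR_gt0.
by field.
Qed.

End Spectral.

(** * Low-order coefficients of the numerator *)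

Lemma coef_prod_linear (R : comNzRingType) I (r : seq I) (a : I -> R) :
  let p := \prod_(i <- r) (1 + a i *: 'X) : {poly R} in
  p`_0 = 1 /\ p`_1 = \sum_(i <- r) a i.
Proof.
elim: r => [|i r [IH0 IH1]]/=; first by rewrite !big_nil !coefC.
by rewrite !big_cons !mulrDl !mul1r -!scalerAl !coefD !coefZ !coefXM/= IH0 IH1
  mulr0 mulr1 addr0 addrC.
Qed.

Lemma sum_sign_wt (R : pzRingType) n (l : bits n) :
  \sum_(i < n) (-1) ^+ l i = n%:R - 2 * (wt l)%:R :> R.
Proof.
rewrite /wt natr_sum mulr_sumr.
have -> : n%:R = \sum_(i < n) 1 :> R by rewrite sumr_const card_ord.
rewrite -sumrB; apply: eq_bigr => i _; case: (l i); rewrite ?expr1 ?expr0 ?mulr0 ?subr0//.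
by rewrite mulr1 opprD addNKr.
Qed.

(** From [1 - y <= expR (- y)] one gets [expR y <= 1 / (1 - y)], and [(1 + y + 2 y^2)(1 - y) = 1 +
    y^2 (1 - 2 y)] is at least 1 when [y <= 1/2]. *)
Lemma expR_le_quad (R : realType) (y : R) : y <= 2^-1 -> expR y <= 1 + y + 2 * y ^+ 2.
Proof.
move=> y2; have y1 : 0 < 1 - y by lra.
have : expR y * (1 - y) <= 1.
  rewrite -[leRHS](@expR0 R) -(subrr y) expRD ler_wpM2l ?expR_ge0//.
  exact: (le_trans _ (expR_ge1Dx (- y))).
rewrite -ler_pdivlMr// => /le_trans; apply.
by rewrite ler_pdivrMr//; nra.
Qed.

(** * Chernoff bound as a finite sum over sign patterns *)

Section Tail.
Variable R : realType.
Implicit Types p e : R.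

Definition sgb (b : bool) : R := if b then 1 else -1.
Definition bern p (b : bool) : R := if b then p else 1 - p.

(* Exponential moment of [sgb - (2 p - 1) - e] under [bern p], at the parameter
   [e / 16], which is small enough for the quadratic bound on [expR] to win. *)
Lemma chernoff_rate p e : 0 <= p <= 1 -> 0 < e -> e <= 1 ->
  expR (- (e / 16) * e) * (p * expR (e / 16 * (1 - (2 * p - 1)))
    + (1 - p) * expR (e / 16 * (- 1 - (2 * p - 1)))) <= expR (- (e ^+ 2 / 32)).
Proof.
move=> /andP[p0 p1] e0 e1.
have h1 := expR_le_quad R (e / 16 * (1 - (2 * p - 1))) ltac:(nra).
have h2 := expR_le_quad R (e / 16 * (- 1 - (2 * p - 1))) ltac:(nra).
have h : p * expR (e / 16 * (1 - (2 * p - 1))) + (1 - p) * expR (e / 16 * (- 1 - (2 * p - 1)))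
   <= 1 + e ^+ 2 / 32.
  have q0 : 0 <= 1 - p by lra.
  apply: le_trans (lerD (ler_wpM2l p0 h1) (ler_wpM2l q0 h2)) _.
  set q := p * (1 - p).
  have qle : q <= 1 by rewrite /q; nra.
  (* The linear terms cancel because the centred sign has mean 0; its variance is [4 q], and
     [2 * (e / 16)^2 * 4 q = e^2 / 32 * q]. *)
  rewrite [leLHS](_ : _ = 1 + e ^+ 2 / 32 * q); first last.
    by rewrite /q; field.
  by rewrite lerD2l ger_pMr; nra.
apply: le_trans (ler_wpM2l (expR_ge0 _) (le_trans h (expR_ge1Dx _))) _.
by rewrite -expRD ler_expR; lra.
Qed.

(** On a deviating pattern the exponential weight is at least 1. Inserting it and then summing over
    all patterns bounds the tail by the [N]-th power of a one-sign moment. *)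
Lemma upper_tail_sum p e N : 0 <= p <= 1 -> 0 < e -> e <= 1 ->
  \sum_(a : {ffun 'I_N -> bool} | e * N%:R <= \sum_i (sgb (a i) - (2 * p - 1)))
    \prod_i bern p (a i) <= expR (- (e ^+ 2 / 32)) ^+ N.
Proof.
move=> p01 e0 e1; have [p0 p1] := andP p01.
have bern_ge0 b : 0 <= bern p b by rewrite /bern; case: b => //; rewrite subr_ge0.
pose w b := bern p b * expR (e / 16 * (sgb b - (2 * p - 1) - e)).
have w_ge0 b : 0 <= w b by rewrite mulr_ge0// expR_ge0.
apply: (@le_trans _ _ (\sum_(a : {ffun 'I_N -> bool}) \prod_i w (a i))).
  rewrite big_mkcond/=; apply: ler_sum => a _; case: ifP => [dev|_]; last first.
    by apply: prodr_ge0.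
  rewrite big_split/= -expR_sum ler_peMr ?prodr_ge0//.
  rewrite -[leLHS](@expR0 R) ler_expR -mulr_sumr mulr_ge0//; first by rewrite divr_ge0// ltW.
  by rewrite sumrB subr_ge0 sumr_const card_ord -(mulr_natr e).
rewrite -(bigA_distr_bigA (fun _ => w)) prodr_const card_ord lerXn2r ?nnegrE ?expR_ge0//.
  by apply: sumr_ge0.
apply: le_trans (chernoff_rate p e p01 e0 e1).
have split_exp b : w b = expR (- (e / 16) * e)
    * (bern p b * expR (e / 16 * (sgb b - (2 * p - 1)))).
  by rewrite mulrCA -expRD; congr (_ * expR _); ring.
by rewrite big_bool/= !split_exp -mulrDr.
Qed.

(** The lower tail for [p] is the upper tail for [1 - p] after negating every bit. *)
Lemma tail_sum p e N : 0 <= p <= 1 -> 0 < e -> e <= 1 ->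
  \sum_(a : {ffun 'I_N -> bool} | e * N%:R <= `| \sum_i (sgb (a i) - (2 * p - 1)) |)
    \prod_i bern p (a i) <= 2 * expR (- (e ^+ 2 / 32)) ^+ N.
Proof.
move=> p01 e0 e1; have [p0 p1] := andP p01.
have bern_ge0 b : 0 <= bern p b by rewrite /bern; case: b => //; rewrite subr_ge0.
have up := upper_tail_sum p e N p01 e0 e1.
have p01' : 0 <= 1 - p <= 1 by apply/andP; split; lra.
have := upper_tail_sum (1 - p) e N p01' e0 e1.
pose neg (a : {ffun 'I_N -> bool}) := [ffun i => ~~ a i] : {ffun 'I_N -> bool}.
have negK : involutive neg by move=> a; apply/ffunP => i; rewrite !ffunE negbK.
rewrite (reindex_inj (inv_inj negK))/=.
rewrite (eq_bigl (fun a : {ffun 'I_N -> bool} =>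
  e * N%:R <= - \sum_i (sgb (a i) - (2 * p - 1)))); last first.
  move=> a; congr (_ <= _); rewrite -sumrN; apply: eq_bigr => i _.
  by rewrite ffunE /sgb; case: (a i) => /=; ring.
rewrite (eq_bigr (fun a : {ffun 'I_N -> bool} => \prod_i bern p (a i))); last first.
  move=> a _; apply: eq_bigr => i _; rewrite ffunE /bern.
  by case: (a i) => //=; rewrite opprB addrCA subrr addr0.
move=> down; rewrite [leRHS]mulr_natl mulr2n; apply: le_trans (lerD up down).
rewrite [leLHS]big_mkcond [X in _ <= X + _]big_mkcond [X in _ <= _ + X]big_mkcond.
rewrite -big_split; apply: ler_sum => a _ /=.
have q0 : 0 <= \prod_i bern p (a i) by apply: prodr_ge0.
by rewrite ler_normr; case: (e * _ <= _); case: (e * _ <= _) => /=;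
  rewrite ?addr0 ?add0r ?ler_wpDl.
Qed.

End Tail.

(** * Almost sure convergence of the empirical mean by Borel-Cantelli *)

Section StrongLaw.
Variables (R : realType) (d : measure_display) (Omega : measurableType d).
Variables (P : probability Omega R) (p : R) (o : nat -> Omega -> R).
Hypothesis mo : forall k, measurable_fun setT (o k).
Hypothesis o_sign : forall k t, o k t = 1 \/ o k t = -1.
Hypothesis Po : forall k, P [set t | o k t = 1] = p%:E.
Hypothesis indep : mutually_independent P o.
Local Notation sgb := (sgb R).
Local Notation bern := (bern R).

(* Defined from a sequence of sets indexed by [nat] because that is what
   [mutually_independent] takes. *)
Definition cyl N (a : {ffun 'I_N -> bool}) : set Omega :=
  \big[setI/setT]_(k <- iota 0 N)
    (o k @^-1` [set y | if insub k is Some i then y = sgb (a i) else True]).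

Lemma prob01 : 0 <= p <= 1.
Proof.
rewrite -!lee_fin -(Po 0%N) measure_ge0 probability_le1//.
by have := mo 0%N measurableT _ (measurable_set1 1); rewrite setTI.
Qed.

Lemma measurable_sign k b : measurable (o k @^-1` [set sgb b]).
Proof. by rewrite -[X in measurable X]setTI; exact: mo. Qed.

Lemma prob_sign k b : P (o k @^-1` [set sgb b]) = (bern p b)%:E.
Proof.
case: b => /=; first exact: Po.
rewrite (_ : _ @^-1` _ = ~` (o k @^-1` [set sgb true])).
  rewrite probability_setC; last exact: measurable_sign.
  by rewrite [X in (_ - X)%E]Po.
apply/seteqP; split => t /=; rewrite /sgb.
  by move=> -> /eqP; rewrite eq_sym -subr_eq0 opprK -mulr2n pnatr_eq0.
by case: (o_sign k t).
Qed.

Lemma cyl_factor_measurable N (a : {ffun 'I_N -> bool}) k :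
  measurable [set y | if insub k is Some i then y = sgb (a i) else True].
Proof.
case: insub => [i|]; first exact: measurable_set1.
exact: measurableT.
Qed.

Lemma measurable_cyl N a : measurable (@cyl N a).
Proof.
apply: bigsetI_measurable => k _; rewrite -[X in measurable X]setTI.
apply: mo => //; exact: cyl_factor_measurable.
Qed.

Lemma prob_cyl N a : P (@cyl N a) = (\prod_i bern p (a i))%:E.
Proof.
rewrite /cyl indep ?iota_uniq//; last exact: cyl_factor_measurable.
rewrite -[X in iota 0 X]subn0 -/(index_iota 0 N) big_mkord.
rewrite -prodEFin; apply: eq_bigr => i _.
by rewrite valK prob_sign.
Qed.

Lemma cylP N (t : Omega) : cyl N [ffun i : 'I_N => o i t == 1] t.
Proof.
rewrite /cyl -bigcap_seq => k _ /=; case: insubP => // i _ ki.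
rewrite ffunE ki /sgb; case: eqP => // o1.
by case: (o_sign k t).
Qed.

(** For [N > 0], the event that [F_est o N] is at least [e] away from [2 * p - 1]. Writing it as a
    finite union of cylinders gives measurability and the union bound. *)
Definition deviation (e : R) N : set Omega :=
  \big[setU/set0]_(a : {ffun 'I_N -> bool} |
    e * N%:R <= `| \sum_i (sgb (a i) - (2 * p - 1)) |) cyl N a.

Lemma measurable_deviation e N : measurable (deviation e N).
Proof. by apply: bigsetU_measurable => a _; exact: measurable_cyl. Qed.

Lemma prob_deviation e N : 0 < e -> e <= 1 ->
  (P (deviation e N) <= (2 * expR (- (e ^+ 2 / 32)) ^+ N)%:E)%E.
Proof.
move=> e0 e1; apply: (@le_trans _ _ (\sum_(a : {ffun 'I_N -> bool} |
    (e * N%:R <= `| \sum_i (sgb (a i) - (2 * p - 1)) |)%R) P (cyl N a))%E); last first.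
  under eq_bigr do rewrite prob_cyl.
  by rewrite sumEFin lee_fin; apply: tail_sum => //; exact: prob01.
rewrite /deviation; elim: (index_enum _) => [|a r IH]; first by rewrite !big_nil measure0.
rewrite !big_cons; case: ifP => // _.
apply: le_trans (measureU2 _ _ _) _; first exact: measurable_cyl.
  by apply: bigsetU_measurable => b _; exact: measurable_cyl.
exact: leeD2l.
Qed.

Lemma summable_deviation e : 0 < e -> e <= 1 -> (\sum_(0 <= N <oo) P (deviation e N) < +oo)%E.
Proof.
move=> e0 e1; set q := expR (- (e ^+ 2 / 32)).
have q0 : 0 <= q by exact: expR_ge0.
have q1 : q < 1 by rewrite -(@expR0 R) ltr_expR oppr_lt0 divr_gt0// exprn_gt0.
apply: (@le_lt_trans _ _ (2 / (1 - q))%:E); last by rewrite ltry.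
apply: lime_le; first by apply: is_cvg_nneseries => k _ _; exact: measure_ge0.
apply: nearW => N; apply: (@le_trans _ _ (\sum_(0 <= k < N) (2 * q ^+ k)%:E)%E).
  by apply: lee_sum => k _; exact: prob_deviation.
rewrite sumEFin lee_fin; apply: geometric_le_lim => //; first exact: expR_gt0.
by rewrite ger0_norm.
Qed.

Lemma strong_law : {ae P, forall t, F_est o ^~ t @ \oo --> 2 * p - 1}.
Proof.
have close e : 0 < e -> e <= 1 ->
    {ae P, forall t, \forall N \near \oo, `|2 * p - 1 - F_est o N t| <= e}.
  (* The exceptional null set consists of the outcomes lying in infinitely many deviation events. *)
  move=> e0 e1; exists (lim_sup_set (deviation e)); split.
  - apply: bigcapT_measurable => k; apply: bigcup_measurable => j _.
    exact: measurable_deviation.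
  - by apply: lim_sup_set_cvg0; [exact: measurable_deviation|exact: summable_deviation].
  move=> t /= far M _; apply: contrapT => noM; apply: far.
  (* Starting at [M.+1] keeps [N] positive, as the division in [F_est] requires. *)
  exists M.+1 => // N /= MN; have N0 : (0 < N%:R :> R) by rewrite ltr0n (leq_trans _ MN).
  rewrite leNgt; apply/negP => devN; apply: noM; exists N; first exact: ltnW.
  rewrite /deviation -bigcup_seq_cond/=; exists [ffun i : 'I_N => o i t == 1]; last exact: cylP.
  rewrite /= mem_index_enum/= -ler_pdivlMr// ltW//.
  have -> : \sum_(i < N) (sgb ([ffun i0 : 'I_N => o i0 t == 1] i) - (2 * p - 1))
      = N%:R * (F_est o N t - (2 * p - 1)).
    rewrite sumrB sumr_const card_ord mulrBr mulVKf ?gt_eqF// -(mulr_natl (2 * p - 1)).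
    congr (_ - _); apply: eq_bigr => i _; rewrite ffunE /sgb.
    by case: eqP => [->//|]; case: (o_sign i t).
  by rewrite normrM gtr0_norm// mulrAC mulfV ?gt_eqF// mul1r distrC.
(* Only countably many tolerances are used, so the null sets can be united. *)
have ae_close : {ae P, forall t, forall k,
    \forall N \near \oo, `|2 * p - 1 - F_est o N t| <= k.+1%:R^-1}.
  apply: ae_foralln => k; apply: close; first by rewrite invr_gt0.
  by rewrite invf_le1// ler1n.
apply: filterS ae_close => t tk; apply/cvgrPdist_le => e e0.
have [k /ltW ke] := ltr_add_invr e0.
rewrite add0r in ke; apply: filterS (tk k) => N /le_trans; exact.
Qed.

End StrongLaw.

(** * The remainder polynomial and the limit *)

Theorem theorem2 (R : realType) (n : nat) (adj : rel 'I_n)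
  (adj_sym : symmetric adj) (adj_irr : irreflexive adj) (l : bits n) :
  exists r : {poly R}, r`_0 = 0 /\ r`_1 = 0 /\
  forall (kB T : R), 0 < kB -> 0 < T ->
  let beta := (kB * T)^-1 in
  let x := expR (- (2 * beta)) in
  let rho := thermal_state adj beta in
  forall (d : measure_display) (Omega : measurableType d)
         (P : probability Omega R) (o : nat -> Omega -> R),
    (forall k, measurable_fun setT (o k)) ->
    (forall k t, o k t = 1 \/ o k t = -1) ->
    (forall k, P [set t | o k t = 1]
               = (outcome_prob rho (S_op adj l) 1)%:E) ->
    mutually_independent P o ->
    {ae P, forall t,
      (fun N => `| fidelity adj rho - F_est o N t |) @ \oo -->
      `| ((n%:R - 2 * (wt l)%:R) * x + r.[x]) | / (1 + x) ^+ n}.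
Proof.
(* At [x], [q] is the numerator of [Tr(rho_T S_l)]. It depends on [l] alone, so one remainder serves
   all temperatures. *)
pose q : {poly R} := \prod_(i < n) (1 + (-1) ^+ l i *: 'X).
have [q0 q1] := coef_prod_linear R _ (index_enum _) (fun i : 'I_n => (-1) ^+ l i).
exists (q - 1 - (n%:R - 2 * (wt l)%:R) *: 'X).
split; first by rewrite !coefD !coefN coefZ coefX coef1 q0 mulr0 subrr subr0.
split; first by rewrite !coefD !coefN coefZ coefX coef1 q1 sum_sign_wt /=; ring.
move=> kB T kB0 T0 beta x rho d Omega P o mo o_sign Po indep.
apply: filterS (strong_law _ _ _ _ _ o mo o_sign Po indep) => t lim_o.
have x0 : 0 < 1 + x by rewrite addr_gt0// expR_gt0.
(* The linear term plus the remainder is [q.[x] - 1], the negative of the numerator of fidelity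
   minus mean; the absolute value absorbs the sign. *)
have -> : `|(n%:R - 2 * (wt l)%:R) * x + (q - 1 - (n%:R - 2 * (wt l)%:R) *: 'X).[x]|
    / (1 + x) ^+ n = `|fidelity adj rho - (2 * outcome_prob rho (S_op adj l) 1 - 1)|.
  rewrite fidelity_thermal// outcome_prob_thermal// -/x.
  set y := (1 + x) ^+ n; set z := \prod_(i < n) _.
  have -> : y^-1 - z / y = (1 - z) / y by rewrite mulrBl mul1r.
  rewrite normrM [X in _ = _ * X]ger0_norm; last first.
    by rewrite invr_ge0 exprn_ge0// ltW.
  congr (_ / _); rewrite distrC !(hornerD, hornerN) hornerZ hornerX -polyC1 hornerC.
  have -> : q.[x] = z.
    by rewrite horner_prod; apply: eq_bigr => i _; rewrite !hornerE.
  by congr (`|_|); ring.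
by apply: cvg_norm; apply: cvgB => //; exact: cvg_cst.
Qed.
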